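(* Let $\Lambda=kQ/I$ be a bound quiver algebra. If $Q$ has no oriented cycles, then $\mathsf{HH}_n^\tau(\Lambda,\Lambda)=0$ for all $n\geq 1$.
   Context: Let $k$ be a field. All modules and bimodules are finite dimensional over $k$; $D=\mathrm{Hom}_k(-,k)$; $\otimes=\otimes_k$. Bound quiver algebra: $Q$ is a finite quiver, $F$ is the ideal of $kQ$ generated by the arrows, $I$ is an admissible ideal ($F^m\subset I\subset F^2$ for some $m\ge 2$), and $\Lambda=kQ/I$. $\Lambda$-bimodules are left $\Lambda\otimes\Lambda^{\mathrm{op}}$-modules, and $\mathrm{Hom}_{\Lambda-\Lambda}$ denotes bimodule morphisms. $\tau$-Hochschild homology: $\Omega^{m}$ is the $m$-th syzygy of bimodules taken with minimal projective resolutions ($\Omega^0=\mathrm{id}$); $\mathrm{Tr}M$ is the transpose, i.e. the cokernel of $\mathrm{Hom}(P_0,\Lambda\otimes\Lambda^{\mathrm{op}})\to\mathrm{Hom}(P_1,\Lambda\otimes\Lambda^{\mathrm{op}})$ for a minimal projective presentation $P_1\to P_0\to M\to 0$; $\tau=D\,\mathrm{Tr}$ is the Auslander–Reiten translate for $\Lambda$-bimodules; $\tau_n=\tau\Omega^{n-1}$ for $n\ge1$. For a $\Lambda$-bimodule $X$ and $n\geq 1$: $\mathsf{HH}_n^\tau(\Lambda,X)=\mathrm{Hom}_{\Lambda-\Lambda}(DX,\tau_n\Lambda)$. *)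

(* Defs.v *)
From HB Require Import structures.
From mathcomp Require Import all_boot all_order all_algebra all_field.
From mathcomp Require Import finmap.
From mathcomp Require Import monalg.

Set Implicit Arguments.
Unset Strict Implicit.
Unset Printing Implicit Defensive.

Import GRing.Theory.
Local Open Scope ring_scope.

Record quiver := Quiver {
  vertex : finType;
  arrow : finType;
  asource : arrow -> vertex;
  atarget : arrow -> vertex }.

Section Paths.
Variable Q : quiver.
Implicit Types (x : vertex Q) (s : seq (arrow Q)).

Fixpoint composable x s :=
  if s is a :: s' then (asource a == x) && composable (atarget a) s' else true.

(* The pair (x, s) is the path that starts at x and runs through the arrows
   of s in order; (x, [::]) is the stationary path at x. *)
Record qpath := QPath {
  qpath_val : vertex Q * seq (arrow Q);
  qpathP : composable qpath_val.1 qpath_val.2 }.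

HB.instance Definition _ := [isSub for qpath_val].
HB.instance Definition _ := [Choice of qpath by <:].

Definition psource (p : qpath) : vertex Q := (qpath_val p).1.
Definition parrows (p : qpath) : seq (arrow Q) := (qpath_val p).2.
Definition ptarget (p : qpath) : vertex Q :=
  last (psource p) (map (@atarget Q) (parrows p)).
Definition plength (p : qpath) : nat := size (parrows p).

Definition stationary x : qpath := @QPath (x, [::]) isT.

Lemma composable_arrow (a : arrow Q) : composable (asource a) [:: a].
Proof. by rewrite /= eqxx. Qed.

Definition arrow_path (a : arrow Q) : qpath :=
  @QPath (asource a, [:: a]) (composable_arrow a).

Lemma composable_cat x s1 s2 :
  composable x (s1 ++ s2) =
  composable x s1 && composable (last x (map (@atarget Q) s1)) s2.
Proof. by elim: s1 x => //= a s1 IH x; rewrite IH andbA. Qed.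

(* First p, then q; only meaningful when ptarget p = psource q. *)
Definition pcat (p q : qpath) : qpath :=
  insubd p (psource p, parrows p ++ parrows q).

Lemma pcatE p q : ptarget p = psource q ->
  qpath_val (pcat p q) = (psource p, parrows p ++ parrows q).
Proof.
move=> pq; rewrite /pcat val_insubd /= composable_cat.
by rewrite (qpathP p) -/(ptarget p) pq (qpathP q).
Qed.

Lemma psource_cat p q : ptarget p = psource q -> psource (pcat p q) = psource p.
Proof. by move=> pq; rewrite {1}/psource pcatE. Qed.

Lemma parrows_cat p q : ptarget p = psource q ->
  parrows (pcat p q) = parrows p ++ parrows q.
Proof. by move=> pq; rewrite {1}/parrows pcatE. Qed.

Lemma ptarget_cat p q : ptarget p = psource q -> ptarget (pcat p q) = ptarget q.
Proof.
move=> pq; rewrite /ptarget psource_cat // parrows_cat // map_cat last_cat.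
by rewrite -/(ptarget p) pq.
Qed.

Lemma qpath_eq p q : psource p = psource q -> parrows p = parrows q -> p = q.
Proof.
by move=> e1 e2; apply: val_inj => /=; rewrite (surjective_pairing (qpath_val p))
  (surjective_pairing (qpath_val q)) -/(psource p) -/(parrows p) e1 e2.
Qed.

Lemma pcatA p q r : ptarget p = psource q -> ptarget q = psource r ->
  pcat p (pcat q r) = pcat (pcat p q) r.
Proof.
move=> pq qr; have pqr : ptarget p = psource (pcat q r) by rewrite psource_cat.
have pqr' : ptarget (pcat p q) = psource r by rewrite ptarget_cat.
by apply: qpath_eq; rewrite ?psource_cat ?parrows_cat ?catA.
Qed.

Lemma pcat0p p : pcat (stationary (psource p)) p = p.
Proof. by apply: qpath_eq; rewrite ?psource_cat ?parrows_cat. Qed.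

Lemma pcatp0 p : pcat p (stationary (ptarget p)) = p.
Proof. by apply: qpath_eq; rewrite ?psource_cat ?parrows_cat ?cats0. Qed.

End Paths.

Definition acyclic (Q : quiver) : Prop :=
  forall p : qpath Q, psource p = ptarget p -> plength p = 0%N.

Lemma bilinear_assoc (k : fieldType) (V : lmodType k) (I : Type) (b : I -> V)
    (mul : V -> V -> V) :
  (forall P : V -> Prop, P 0 -> (forall x y, P x -> P y -> P (x + y)) ->
    (forall c i, P (c *: b i)) -> forall x, P x) ->
  left_distributive mul +%R -> right_distributive mul +%R ->
  (forall c x y, mul (c *: x) y = c *: mul x y) ->
  (forall c x y, mul x (c *: y) = c *: mul x y) ->
  (forall i j l, mul (b i) (mul (b j) (b l)) = mul (mul (b i) (b j)) (b l)) ->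
  associative mul.
Proof.
move=> ind mulDl mulDr mulZl mulZr mulA x y z.
have mul0l t : mul 0 t = 0 by have := mulZl 0 0 t; rewrite !scale0r.
have mul0r t : mul t 0 = 0 by have := mulZr 0 t 0; rewrite !scale0r.
elim/ind: x => [|x1 x2 e1 e2|c i].
- by rewrite !mul0l.
- by rewrite !mulDl e1 e2.
rewrite !mulZl; congr (_ *: _); elim/ind: y => [|y1 y2 e1 e2|{}c j].
- by rewrite !(mul0l, mul0r).
- by rewrite !(mulDl, mulDr) e1 e2.
rewrite !(mulZl, mulZr); congr (_ *: _).
elim/ind: z => [|z1 z2 e1 e2|{}c l].
- by rewrite !mul0r.
- by rewrite !mulDr e1 e2.
by rewrite !mulZr mulA.
Qed.

(* The path p as an element of kQ, locked so that unification never unfolds it. *)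
HB.lock Definition pbasis (k : fieldType) (Q : quiver) (p : qpath Q) :
  {malg k[qpath Q]} := mkmalgU p 1.

Section PathAlgebra.
Variables (k : fieldType) (Q : quiver).
Local Notation kQ := {malg k[qpath Q]}.
Local Notation coef p x := (mcoeff p x).
Local Notation supp x := (msupp x).
Implicit Types (p q r : qpath Q) (x y z : kQ).

Local Notation pbasis := (pbasis k).

(* p q means first p, then q, and is 0 when the paths do not compose. *)
Definition ppmul p q : kQ :=
  if ptarget p == psource q then pbasis (pcat p q) else 0.

Definition pamul x y : kQ :=
  \sum_(p <- supp x) \sum_(q <- supp y) (coef p x * coef q y) *: ppmul p q.

Definition paone : kQ := \sum_(v : vertex Q) pbasis (stationary v).

Lemma coefD p x y : coef p (x + y) = coef p x + coef p y.
Proof. exact: mcoeffD. Qed.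

Lemma coefZ p c x : coef p (c *: x) = c * coef p x.
Proof. exact: mcoeffZ. Qed.

Lemma coef_basis p q : coef q (pbasis p) = (p == q)%:R.
Proof. by rewrite pbasis.unlock; exact: mcoeffU. Qed.

Lemma supp_basis p : supp (pbasis p) = [fset p]%fset.
Proof. by rewrite pbasis.unlock [LHS]msuppU oner_eq0. Qed.

Lemma pathalgE x : x = \sum_(p <- supp x) coef p x *: pbasis p.
Proof.
rewrite [LHS]monalgE; apply: eq_bigr => p _.
by apply/malgP => q; rewrite mcoeffU [RHS]coefZ coef_basis mulr_natr.
Qed.

Lemma pamulEw (d1 d2 : {fset qpath Q}) x y :
  (supp x `<=` d1)%fset -> (supp y `<=` d2)%fset ->
  pamul x y = \sum_(p <- d1) \sum_(q <- d2) (coef p x * coef q y) *: ppmul p q.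
Proof.
move=> le1 le2; rewrite /pamul (big_fset_incl _ le1) /=.
  apply: eq_bigr => p _; apply: big_fset_incl => // q _ /mcoeff_outdom ->.
  by rewrite mulr0 scale0r.
move=> p _ /mcoeff_outdom xp; rewrite big1 // => q _.
by rewrite xp mul0r scale0r.
Qed.

Lemma pamulDl : left_distributive pamul +%R.
Proof.
move=> x y z; rewrite (pamulEw (msuppD_le _ _) (fsubset_refl _)).
rewrite (pamulEw (fsubsetUl (supp x) (supp y)) (fsubset_refl _)).
rewrite (pamulEw (fsubsetUr (supp x) (supp y)) (fsubset_refl _)).
rewrite -big_split; apply: eq_bigr => p _ /=; rewrite -big_split.
by apply: eq_bigr => q _ /=; rewrite coefD mulrDl scalerDl.
Qed.

Lemma pamulDr : right_distributive pamul +%R.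
Proof.
move=> z x y; rewrite (pamulEw (fsubset_refl _) (msuppD_le _ _)).
rewrite (pamulEw (fsubset_refl _) (fsubsetUl (supp x) (supp y))).
rewrite (pamulEw (fsubset_refl _) (fsubsetUr (supp x) (supp y))).
rewrite -big_split; apply: eq_bigr => p _ /=; rewrite -big_split.
by apply: eq_bigr => q _ /=; rewrite coefD mulrDr scalerDl.
Qed.

Lemma pamulZl c x y : pamul (c *: x) y = c *: pamul x y.
Proof.
rewrite (pamulEw (msuppZ_le c x) (fsubset_refl _)) scaler_sumr.
apply: eq_bigr => p _; rewrite scaler_sumr; apply: eq_bigr => q _.
by rewrite coefZ scalerA mulrA.
Qed.

Lemma pamulZr c x y : pamul x (c *: y) = c *: pamul x y.
Proof.
rewrite (pamulEw (fsubset_refl _) (msuppZ_le c y)) scaler_sumr.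
apply: eq_bigr => p _; rewrite scaler_sumr; apply: eq_bigr => q _.
by rewrite coefZ scalerA mulrCA.
Qed.

Lemma pamul0l y : pamul 0 y = 0.
Proof. by have := pamulZl 0 0 y; rewrite !scale0r. Qed.

Lemma pamul0r y : pamul y 0 = 0.
Proof. by have := pamulZr 0 y 0; rewrite !scale0r. Qed.

Lemma pamul_suml I (s : seq I) (F : I -> kQ) y :
  pamul (\sum_(i <- s) F i) y = \sum_(i <- s) pamul (F i) y.
Proof.
by apply: (big_morph (pamul^~ y)) => [x z|]; rewrite ?pamulDl ?pamul0l.
Qed.

Lemma pamul_sumr I (s : seq I) (F : I -> kQ) y :
  pamul y (\sum_(i <- s) F i) = \sum_(i <- s) pamul y (F i).
Proof.
by apply: (big_morph (pamul y)) => [x z|]; rewrite ?pamulDr ?pamul0r.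
Qed.

Lemma pamul_basis p q : pamul (pbasis p) (pbasis q) = ppmul p q.
Proof.
by rewrite /pamul !supp_basis !big_seq_fset1 !coef_basis !eqxx mulr1 scale1r.
Qed.

Lemma pathalg_ind (P : kQ -> Prop) :
  P 0 -> (forall x y, P x -> P y -> P (x + y)) ->
  (forall c p, P (c *: pbasis p)) -> forall x, P x.
Proof. by move=> P0 PD PZ x; rewrite (pathalgE x); elim/big_ind: _. Qed.

Lemma pamulA_basis p q r :
  pamul (pbasis p) (ppmul q r) = pamul (ppmul p q) (pbasis r).
Proof.
rewrite /ppmul; case: (eqVneq (ptarget p) (psource q)) => pq;
  case: (eqVneq (ptarget q) (psource r)) => qr.
- rewrite !pamul_basis /ppmul psource_cat // ptarget_cat // pq qr !eqxx.
  by rewrite pcatA.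
- by rewrite pamul0r pamul_basis /ppmul ptarget_cat // (negPf qr).
- by rewrite pamul0l pamul_basis /ppmul psource_cat // (negPf pq).
- by rewrite pamul0l pamul0r.
Qed.

Lemma pamulA : associative pamul.
Proof.
apply: (bilinear_assoc pathalg_ind pamulDl pamulDr pamulZl pamulZr) => p q r.
by rewrite !pamul_basis pamulA_basis.
Qed.

Lemma pamul1l : left_id paone pamul.
Proof.
elim/pathalg_ind => [|x y ex ey|c p].
- exact: pamul0r.
- by rewrite pamulDr ex ey.
rewrite pamulZr; congr (_ *: _); rewrite pamul_suml (bigD1 (psource p)) //=.
rewrite big1 => [|v /negPf vp]; rewrite pamul_basis /ppmul /=.
  by rewrite eqxx pcat0p addr0.
by rewrite /ptarget /= vp.
Qed.

Lemma pamul1r : right_id paone pamul.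
Proof.
elim/pathalg_ind => [|x y ex ey|c p].
- exact: pamul0l.
- by rewrite pamulDl ex ey.
rewrite pamulZl; congr (_ *: _); rewrite pamul_sumr (bigD1 (ptarget p)) //=.
rewrite big1 => [|v /negPf vp]; rewrite pamul_basis /ppmul /=.
  by rewrite eqxx pcatp0 addr0.
by rewrite /psource /= eq_sym vp.
Qed.

End PathAlgebra.

Definition pathalg (k : fieldType) (Q : quiver) : Type :=
  {malg k[qpath Q]}.

HB.instance Definition _ (k : fieldType) (Q : quiver) :=
  GRing.Lmodule.on (pathalg k Q).

HB.instance Definition _ (k : fieldType) (Q : quiver) :=
  GRing.Zmodule_isPzRing.Build (pathalg k Q) (@pamulA k Q) (@pamul1l k Q)
    (@pamul1r k Q) (@pamulDl k Q) (@pamulDr k Q).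

Lemma pathalg_scaleAl (k : fieldType) (Q : quiver) (c : k) (x y : pathalg k Q) :
  (c *: x) * y = c *: (x * y).
Proof. exact: pamulZl. Qed.

Lemma pathalg_scaleAr (k : fieldType) (Q : quiver) (c : k) (x y : pathalg k Q) :
  x * (c *: y) = c *: (x * y).
Proof. exact: pamulZr. Qed.

Section Ideals.
Variable R : pzRingType.
Implicit Types (I J S : R -> Prop) (x y : R).

Definition two_sided_ideal I : Prop :=
  [/\ I 0, forall x y, I x -> I y -> I (x + y)
    & forall a x b, I x -> I (a * x * b)].

Definition ideal_gen S x : Prop :=
  forall J, two_sided_ideal J -> (forall y, S y -> J y) -> J x.

Definition ideal_mul I J : R -> Prop :=
  ideal_gen (fun z => exists x y, [/\ I x, J y & z = x * y]).

Fixpoint ideal_exp I (m : nat) : R -> Prop :=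
  if m is m'.+1 then ideal_mul I (ideal_exp I m') else fun=> True.

End Ideals.

Definition arrow_ideal (k : fieldType) (Q : quiver) : pathalg k Q -> Prop :=
  ideal_gen (fun x : pathalg k Q => exists a : arrow Q, x = pbasis k (arrow_path a) :> pathalg k Q).

Definition admissible (k : fieldType) (Q : quiver) (I : pathalg k Q -> Prop) :=
  two_sided_ideal I /\
  exists2 m, (2 <= m)%N &
    (forall x, ideal_exp (@arrow_ideal k Q) m x -> I x) /\
    (forall x, I x -> ideal_exp (@arrow_ideal k Q) 2 x).

(* L is kQ/I up to isomorphism: pi is surjective with kernel I. An falgType is
   a nonzero algebra, so the quiver has at least one vertex. *)
Definition is_path_quotient (k : fieldType) (Q : quiver)
    (I : pathalg k Q -> Prop) (L : falgType k)
    (pi : {rmorphism pathalg k Q -> L}) : Prop :=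
  [/\ scalable pi, forall y, exists x, pi x = y & forall x, pi x = 0 <-> I x].

(* Left modules over L (x) L^op, with (a (x) b) x = a x b. The two actions being
   k-bilinear and unital, k acts centrally. *)
Record bimodule (k : fieldType) (L : falgType k) := Bimodule {
  bimod :> vectType k;
  lact : L -> bimod -> bimod;
  ract : bimod -> L -> bimod;
  lact_linl : forall x, linear (lact ^~ x);
  lact_linr : forall a, linear (lact a);
  ract_linl : forall a, linear (ract ^~ a);
  ract_linr : forall x, linear (ract x);
  lact1 : forall x, lact 1 x = x;
  ract1 : forall x, ract x 1 = x;
  lactM : forall a b x, lact (a * b) x = lact a (lact b x);
  ractM : forall a b x, ract x (a * b) = ract (ract x a) b;
  lractA : forall a b x, ract (lact a x) b = lact a (ract x b) }.

Arguments lact {k L b} a x : rename.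
Arguments ract {k L b} x a : rename.

Section BimoduleHom.
Variables (k : fieldType) (L : falgType k).
Implicit Types (M N P : bimodule L) (a b : L).

Definition lmap M a : 'End(M) := linfun (@lact k L M a).
Definition rmap M a : 'End(M) := linfun (fun x : M => ract x a).

Lemma lmapE M a (x : M) : lmap M a x = lact a x.
Proof.
pose f := GRing.isLinear.Build k M M _ (@lact k L M a) (@lact_linr k L M a).
pose F : {linear M -> M} := HB.pack (@lact k L M a) f.
exact: (lfunE F).
Qed.

Lemma rmapE M a (x : M) : rmap M a x = ract x a.
Proof.
pose f := GRing.isLinear.Build k M M _ (fun x : M => ract x a) (@ract_linl k L M a).
pose F : {linear M -> M} := HB.pack (fun x : M => ract x a) f.
exact: (lfunE F).
Qed.

Lemma lmap_linear M : linear (lmap M).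
Proof.
move=> c a b; apply/lfunP => x; rewrite add_lfunE scale_lfunE !lmapE.
exact: (@lact_linl k L M x c a b).
Qed.

Lemma rmap_linear M : linear (rmap M).
Proof.
move=> c a b; apply/lfunP => x; rewrite add_lfunE scale_lfunE !rmapE.
exact: (@ract_linr k L M x c a b).
Qed.

HB.instance Definition _ M :=
  GRing.isLinear.Build k L 'End(M) _ (lmap M) (@lmap_linear M).
HB.instance Definition _ M :=
  GRing.isLinear.Build k L 'End(M) _ (rmap M) (@rmap_linear M).

Definition is_bihom M N (f : 'Hom(M, N)) : Prop :=
  (forall a x, f (lact a x) = lact a (f x)) /\
  (forall a x, f (ract x a) = ract (f x) a).

Definition commutator M N (u : 'End(M)) (v : 'End(N)) (f : 'Hom(M, N)) :=
  (f \o u)%VF - (v \o f)%VF.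

Fact commutator_is_linear M N u v : linear (@commutator M N u v).
Proof.
move=> c f g; apply/lfunP => x; rewrite /commutator.
rewrite !(add_lfunE, opp_lfunE, scale_lfunE, comp_lfunE) linearP.
by rewrite scalerBr opprD addrACA.
Qed.
HB.instance Definition _ M N u v := GRing.isLinear.Build k 'Hom(M, N) 'Hom(M, N)
  _ (@commutator M N u v) (@commutator_is_linear M N u v).

Definition bihom M N : {vspace 'Hom(M, N)} :=
  (\bigcap_(i < \dim {:L})
     (lker (linfun (commutator (lmap M (vbasis {:L})`_i) (lmap N (vbasis {:L})`_i)))
      :&: lker (linfun
           (commutator (rmap M (vbasis {:L})`_i) (rmap N (vbasis {:L})`_i)))))%VS.

Lemma bihomP M N (f : 'Hom(M, N)) : f \in bihom M N <-> is_bihom f.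
Proof.
have kerP u v : f \in lker (linfun (@commutator M N u v)) <->
    (forall x, f (u x) = v (f x)).
  rewrite memv_ker lfunE /= /commutator subr_eq0; split=> [/eqP/lfunP e x|e].
    by have := e x; rewrite !lfunE.
  by apply/eqP/lfunP => x; rewrite !lfunE /= e.
split=> [|[fl fr]]; last first.
  rewrite memvE; apply/subv_bigcapP => i _; rewrite -memvE memv_cap.
  by apply/andP; split; apply/kerP => x; rewrite !(lmapE, rmapE).
rewrite memvE => /subv_bigcapP fi.
have {}fi i : (forall x, f (lmap M (vbasis {:L})`_i x) = lmap N (vbasis {:L})`_i (f x))
    /\ (forall x, f (rmap M (vbasis {:L})`_i x) = rmap N (vbasis {:L})`_i (f x)).
  have [lti|gei] := ltnP i (\dim {:L}).
    by have := fi (Ordinal lti) isT; rewrite -memvE => /memv_capP[/kerP ? /kerP ?].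
  rewrite nth_default ?size_tuple //.
  by split=> x; rewrite !linear0 !zero_lfunE linear0.
have sumL T a : lmap T a = \sum_i coord (vbasis {:L}) i a *: lmap T (vbasis {:L})`_i.
  rewrite {1}(coord_vbasis (memvf a)) linear_sum.
  by apply: eq_bigr => i _; rewrite linearZ.
have sumR T a : rmap T a = \sum_i coord (vbasis {:L}) i a *: rmap T (vbasis {:L})`_i.
  rewrite {1}(coord_vbasis (memvf a)) linear_sum.
  by apply: eq_bigr => i _; rewrite linearZ.
split=> a x; rewrite -!(lmapE, rmapE) !(sumL, sumR) !sum_lfunE linear_sum.
  by apply: eq_bigr => i _; rewrite !scale_lfunE linearZ /= (fi i).1.
by apply: eq_bigr => i _; rewrite !scale_lfunE linearZ /= (fi i).2.
Qed.

End BimoduleHom.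

Section Constructions.
Variables (k : fieldType) (L : falgType k).
Implicit Types (M N P X : bimodule L) (a b : L).

Definition regbim : bimodule L.
Proof.
refine (@Bimodule k L L (fun a x => a * x) (fun x b => x * b)
  _ _ _ _ _ _ _ _ _) => [x c a b|a c x y|b c x y|x c a b|x|x|a b x|a b x|a b x].
- by rewrite mulrDl scalerAl.
- by rewrite mulrDr scalerAr.
- by rewrite mulrDl scalerAl.
- by rewrite mulrDr scalerAr.
- exact: mul1r.
- exact: mulr1.
- by rewrite mulrA.
- exact: mulrA.
- by rewrite mulrA.
Defined.

Lemma lmap1 M : lmap M 1 = \1%VF.
Proof. by apply/lfunP => x; rewrite lmapE lact1 id_lfunE. Qed.
Lemma rmap1 M : rmap M 1 = \1%VF.
Proof. by apply/lfunP => x; rewrite rmapE ract1 id_lfunE. Qed.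
Lemma lmapM M a b : lmap M (a * b) = (lmap M a \o lmap M b)%VF.
Proof. by apply/lfunP => x; rewrite comp_lfunE !lmapE lactM. Qed.
Lemma rmapM M a b : rmap M (a * b) = (rmap M b \o rmap M a)%VF.
Proof. by apply/lfunP => x; rewrite comp_lfunE !rmapE ractM. Qed.
Lemma lrmapC M a b : (rmap M b \o lmap M a = lmap M a \o rmap M b)%VF.
Proof. by apply/lfunP => x; rewrite !comp_lfunE !lmapE !rmapE lractA. Qed.

(* D M, with (a f b)(x) = f (b x a) *)
Definition dualbim M : bimodule L.
Proof.
refine (@Bimodule k L 'Hom(M, k^o) (fun a f => f \o rmap M a)%VF
  (fun f b => f \o lmap M b)%VF _ _ _ _ _ _ _ _ _)
  => [f c a b|a c f g|b c f g|f c a b|f|f|a b f|a b f|a b f].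
- by rewrite linearP comp_lfunDr comp_lfunZr.
- by rewrite comp_lfunDl comp_lfunZl.
- by rewrite comp_lfunDl comp_lfunZl.
- by rewrite linearP comp_lfunDr comp_lfunZr.
- by rewrite rmap1 comp_lfun1r.
- by rewrite lmap1 comp_lfun1r.
- by rewrite rmapM comp_lfunA.
- by rewrite lmapM comp_lfunA.
- by rewrite -!comp_lfunA lrmapC.
Defined.

End Constructions.


Section Tensor.
Import VectorInternalTheory.
Variables (k : fieldType) (V : vectType k).

(* V (x) V in coordinates: the entry (i, j) of a tensor is its coefficient on
   e_i (x) e_j, for the coordinate basis (e_i) of V. *)
Definition tensor : Type := 'M[k]_(dim V, dim V).
HB.instance Definition _ := Vector.on tensor.

Definition tens (x y : V) : tensor := (v2r x)^T *m v2r y.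

(* f (x) g *)
Definition tmap (f g : 'End(V)) (t : tensor) : tensor :=
  (f2mx f)^T *m t *m f2mx g.

Lemma tmap_tens f g x y : tmap f g (tens x y) = tens (f x) (g y).
Proof. by rewrite /tmap /tens unlock /= !r2vK trmx_mul !mulmxA. Qed.

Lemma tens_linearl y : linear (tens ^~ y).
Proof. by move=> c x z; rewrite /tens linearP /= linearP /= mulmxDl scalemxAl. Qed.

Lemma tens_linearr x : linear (tens x).
Proof. by move=> c y z; rewrite /tens linearP /= mulmxDr scalemxAr. Qed.

Lemma tens_coord (x y : V) i j : tens x y i j = v2r x 0 i * v2r y 0 j.
Proof. by rewrite mxE big_ord1 mxE. Qed.

Lemma tensE (t : tensor) :
  t = \sum_i \sum_j t i j *: tens (r2v (delta_mx 0 i)) (r2v (delta_mx 0 j)).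
Proof.
rewrite {1}(matrix_sum_delta t); apply: eq_bigr => i _; apply: eq_bigr => j _.
by rewrite /tens !r2vK trmx_delta mul_delta_mx.
Qed.

(* the universal property of V (x) V *)
Lemma tens_ind (W : lmodType k) (f g : {linear tensor -> W}) :
  (forall x y, f (tens x y) = g (tens x y)) -> f =1 g.
Proof.
move=> fg t; rewrite (tensE t) !linear_sum; apply: eq_bigr => i _.
by rewrite !linear_sum; apply: eq_bigr => j _; rewrite !linearZ /= fg.
Qed.

Lemma tens_lift (W : lmodType k) (B : V -> V -> W) :
  (forall y, linear (B ^~ y)) -> (forall x, linear (B x)) ->
  exists f : {linear tensor -> W}, forall x y, f (tens x y) = B x y.
Proof.
move=> Bl Br; pose e i : V := r2v (delta_mx 0 i).
pose f (t : tensor) := \sum_i \sum_j t i j *: B (e i) (e j).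
have flin : linear f.
  move=> c t u; rewrite /f scaler_sumr -big_split; apply: eq_bigr => i _ /=.
  rewrite scaler_sumr -big_split; apply: eq_bigr => j _ /=.
  by rewrite !mxE scalerDl scalerA.
pose F : {linear tensor -> W} :=
  HB.pack f (GRing.isLinear.Build k tensor W _ f flin).
exists F => x y; rewrite -[LHS]/(f _) /f.
have xE z : z = \sum_i v2r z 0 i *: e i.
  apply: v2r_inj; rewrite linear_sum [LHS]row_sum_delta.
  by apply: eq_bigr => i _; rewrite linearZ /= r2vK.
pose Blin z : {linear V -> W} :=
  HB.pack (B ^~ z) (GRing.isLinear.Build k V W _ (B ^~ z) (Bl z)).
pose Brin z : {linear V -> W} :=
  HB.pack (B z) (GRing.isLinear.Build k V W _ (B z) (Br z)).
rewrite [in RHS](xE x) -[RHS]/(Blin _ _) linear_sum.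
apply: eq_bigr => i _; rewrite linearZ /=.
have -> : B (e i) y = \sum_j v2r y 0 j *: B (e i) (e j).
  rewrite {1}(xE y) -[LHS]/(Brin _ _) linear_sum.
  by apply: eq_bigr => j _; rewrite linearZ.
by rewrite scaler_sumr; apply: eq_bigr => j _; rewrite tens_coord scalerA.
Qed.

Fact tmap_is_linear f g : linear (tmap f g).
Proof. by move=> c t u; rewrite /tmap mulmxDr mulmxDl -scalemxAr -scalemxAl. Qed.
HB.instance Definition _ f g :=
  GRing.isLinear.Build k tensor tensor _ (tmap f g) (tmap_is_linear f g).

Lemma tmapM f g f' g' t :
  tmap (f \o f') (g \o g') t = tmap f g (tmap f' g' t).
Proof.
apply: (tens_ind (f := tmap _ _) (g := tmap f g \o tmap f' g')) => x y /=.
by rewrite !tmap_tens !comp_lfunE.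
Qed.

Lemma tmap1 t : tmap \1 \1 t = t.
Proof.
apply: (tens_ind (f := tmap \1 \1) (g := idfun)) => x y /=.
by rewrite tmap_tens !id_lfunE.
Qed.

Lemma tmapDl c f f' g t :
  tmap (c *: f + f') g t = c *: tmap f g t + tmap f' g t.
Proof.
apply: (tens_ind (f := tmap _ _) (g := (c \*: tmap f g) \+ tmap f' g)) => x y /=.
by rewrite !tmap_tens add_lfunE scale_lfunE tens_linearl.
Qed.

Lemma tmapDr c f g g' t :
  tmap f (c *: g + g') t = c *: tmap f g t + tmap f g' t.
Proof.
apply: (tens_ind (f := tmap _ _) (g := (c \*: tmap f g) \+ tmap f g')) => x y /=.
by rewrite !tmap_tens add_lfunE scale_lfunE tens_linearr.
Qed.

End Tensor.

Section Transpose.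
Variables (k : fieldType) (L : falgType k).
Implicit Types (M N P T X Y : bimodule L) (a b : L).

Lemma amulr_1 : amulr 1 = \1%VF :> 'End(L).
Proof. by apply/lfunP => x; rewrite !lfunE /= mulr1. Qed.

(* L (x) L^op as a left module over itself: a (x (x) y) b = (a x) (x) (y b) *)
Definition envbim : bimodule L.
Proof.
refine (@Bimodule k L (tensor L) (fun a t => tmap (amull a) \1 t)
  (fun t b => tmap \1 (amulr b) t)
  _ _ _ _ _ _ _ _ _) => [t c a b|a|b|t c a b|t|t|a b t|a b t|a b t].
- by rewrite linearP tmapDl.
- exact: tmap_is_linear.
- exact: tmap_is_linear.
- by rewrite linearP tmapDr.
- by rewrite amull1 tmap1.
- by rewrite amulr_1 tmap1.
- rewrite -tmapM comp_lfun1l; congr tmap; apply/lfunP => x.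
  by rewrite comp_lfunE !lfunE /= mulrA.
- rewrite -tmapM comp_lfun1l; congr tmap; apply/lfunP => x.
  by rewrite comp_lfunE !lfunE /= mulrA.
- by rewrite -!tmapM !comp_lfun1l !comp_lfun1r.
Defined.


Arguments envbim : simpl never.

(* Right multiplication of L (x) L^op on itself, read as a bimodule structure:
   a (x (x) y) b = (x (x) y)(b (x) a) = (x b) (x) (a y) *)
Definition innerl a : 'End(envbim) := linfun (tmap \1 (amull a)).
Definition innerr b : 'End(envbim) := linfun (tmap (amulr b) \1).

Lemma innerlE a (t : envbim) : innerl a t = tmap \1 (amull a) t.
Proof. exact: (lfunE (tmap \1 (amull a))). Qed.
Lemma innerrE b (t : envbim) : innerr b t = tmap (amulr b) \1 t.
Proof. exact: (lfunE (tmap (amulr b) \1)). Qed.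

Lemma innerl_bihom P a (f : 'Hom(P, envbim)) :
  f \in bihom P envbim -> (innerl a \o f)%VF \in bihom P envbim.
Proof.
move=> /bihomP[fl fr]; apply/bihomP; split=> b x.
  rewrite !comp_lfunE !innerlE fl /= -!tmapM; congr tmap.
    by rewrite comp_lfun1l comp_lfun1r.
  by rewrite comp_lfun1l comp_lfun1r.
rewrite !comp_lfunE !innerlE fr /= -!tmapM; congr tmap.
by apply/lfunP => y; rewrite !comp_lfunE !lfunE /= mulrA.
Qed.

Lemma innerr_bihom P a (f : 'Hom(P, envbim)) :
  f \in bihom P envbim -> (innerr a \o f)%VF \in bihom P envbim.
Proof.
move=> /bihomP[fl fr]; apply/bihomP; split=> b x.
  rewrite !comp_lfunE !innerrE fl /= -!tmapM; congr tmap.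
  by apply/lfunP => y; rewrite !comp_lfunE !lfunE /= mulrA.
rewrite !comp_lfunE !innerrE fr /= -!tmapM; congr tmap.
  by rewrite comp_lfun1l comp_lfun1r.
by rewrite comp_lfun1l comp_lfun1r.
Qed.

Lemma innerl_linear : linear innerl.
Proof.
move=> c a b; apply/lfunP => t; rewrite add_lfunE scale_lfunE !innerlE.
by rewrite linearP tmapDr.
Qed.

Lemma innerr_linear : linear innerr.
Proof.
move=> c a b; apply/lfunP => t; rewrite add_lfunE scale_lfunE !innerrE.
by rewrite linearP tmapDl.
Qed.

Lemma innerl1 : innerl 1 = \1%VF.
Proof. by apply/lfunP => t; rewrite innerlE amull1 tmap1 id_lfunE. Qed.

Lemma innerr1 : innerr 1 = \1%VF.
Proof. by apply/lfunP => t; rewrite innerrE amulr_1 tmap1 id_lfunE. Qed.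

Lemma innerlM a b : innerl (a * b) = (innerl a \o innerl b)%VF.
Proof.
apply/lfunP => t; rewrite comp_lfunE !innerlE -tmapM comp_lfun1l; congr tmap.
by apply/lfunP => y; rewrite comp_lfunE !lfunE /= mulrA.
Qed.

Lemma innerrM a b : innerr (a * b) = (innerr b \o innerr a)%VF.
Proof.
apply/lfunP => t; rewrite comp_lfunE !innerrE -tmapM comp_lfun1l; congr tmap.
by apply/lfunP => y; rewrite comp_lfunE !lfunE /= mulrA.
Qed.

Lemma innerC a b : (innerr b \o innerl a = innerl a \o innerr b)%VF.
Proof.
apply/lfunP => t; rewrite !comp_lfunE !innerlE !innerrE -!tmapM.
by rewrite !comp_lfun1l !comp_lfun1r.
Qed.

(* Hom_{L-L}(P, L (x) L^op), the bimodule structure being the inner one *)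
Definition starbim P : bimodule L.
Proof.
pose H := bihom P envbim.
refine (@Bimodule k L (subvs_of H) (fun a f => vsproj H (innerl a \o vsval f)%VF)
  (fun f b => vsproj H (innerr b \o vsval f)%VF) _ _ _ _ _ _ _ _ _)
  => [f c a b|a c f g|b c f g|f c a b|f|f|a b f|a b f|a b f].
- by rewrite innerl_linear comp_lfunDl -comp_lfunZl linearP.
- by rewrite linearP /= comp_lfunDr -comp_lfunZr linearP.
- by rewrite linearP /= comp_lfunDr -comp_lfunZr linearP.
- by rewrite innerr_linear comp_lfunDl -comp_lfunZl linearP.
- by rewrite innerl1 comp_lfun1l vsvalK.
- by rewrite innerr1 comp_lfun1l vsvalK.
- by rewrite innerlM vsprojK ?comp_lfunA // innerl_bihom // subvsP.
- by rewrite innerrM vsprojK ?comp_lfunA // innerr_bihom // subvsP.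
- rewrite !vsprojK ?innerl_bihom ?innerr_bihom ?subvsP //.
  by rewrite !comp_lfunA innerC.
Defined.


Arguments starbim : simpl never.

(* f |-> f o d; when d is a morphism of bimodules, so is f o d and vsproj does
   nothing *)
Definition starmap P0 P1 (d : 'Hom(P1, P0)) : 'Hom(starbim P0, starbim P1) :=
  linfun (fun f : starbim P0 => vsproj (bihom P1 envbim) (vsval f \o d)%VF : starbim P1).

Lemma starmapE P0 P1 (d : 'Hom(P1, P0)) (f : starbim P0) :
  d \in bihom P1 P0 -> vsval (starmap d f) = (vsval f \o d)%VF.
Proof.
move=> dh; pose F (f : starbim P0) : starbim P1 := vsproj (bihom P1 envbim) (vsval f \o d)%VF.
have Flin : linear F.
  by move=> c g h; rewrite /F linearP /= comp_lfunDl -comp_lfunZl linearP.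
pose FL : {linear starbim P0 -> starbim P1} :=
  HB.pack F (GRing.isLinear.Build k (starbim P0) (starbim P1) _ F Flin).
rewrite [starmap d f](lfunE FL) vsprojK //.
have [fl fr] := (bihomP _).1 (subvsP (f : subvs_of (bihom P0 envbim))).
have [dl dr] := (bihomP _).1 dh.
by apply/bihomP; split=> a x; rewrite !comp_lfunE ?dl ?dr ?fl ?fr.
Qed.

Definition projective P : Prop :=
  forall M N (g : 'Hom(M, N)) (f : 'Hom(P, N)),
    g \in bihom M N -> limg g = fullv -> f \in bihom P N ->
    exists2 h : 'Hom(P, M), h \in bihom P M & (g \o h)%VF = f.

Definition subbimodule M (U : {vspace M}) : Prop :=
  forall a x, x \in U -> lact a x \in U /\ ract x a \in U.

Definition superfluous M (K : {vspace M}) : Prop :=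
  forall U : {vspace M}, subbimodule U -> (U + K = fullv)%VS -> U = fullv.

(* e induces a projective cover of the sub-bimodule U of M *)
Definition projective_cover P M (e : 'Hom(P, M)) (U : {vspace M}) : Prop :=
  [/\ projective P, e \in bihom P M, limg e = U & superfluous (lker e)].

Definition bimodule_iso M N : Prop :=
  exists f : 'Hom(M, N), [/\ f \in bihom M N, lker f = 0%VS & limg f = fullv].

(* Projective covers, kernels and cokernels being unique only up to
   isomorphism, Omega, Tr, tau and tau_n are relations, from the bimodule M to
   the possible values at M. *)
Definition is_syzygy M N : Prop :=
  exists (P : bimodule L) (e : 'Hom(P, M)) (i : 'Hom(N, P)),
    projective_cover e fullv /\ [/\ i \in bihom N P, lker i = 0%VS & limg i = lker e].

Fixpoint is_nth_syzygy (m : nat) M N : Prop :=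
  if m is m'.+1 then exists2 N', is_nth_syzygy m' M N' & is_syzygy N' N
  else bimodule_iso M N.

Definition minimal_presentation M P0 P1 (e : 'Hom(P0, M)) (d : 'Hom(P1, P0)) :=
  projective_cover e fullv /\ projective_cover d (lker e).

Definition is_transpose M T : Prop :=
  exists (P0 P1 : bimodule L) (e : 'Hom(P0, M)) (d : 'Hom(P1, P0))
      (q : 'Hom(starbim P1, T)),
    minimal_presentation e d /\
    [/\ q \in bihom (starbim P1) T, limg q = fullv & lker q = limg (starmap d)].

Definition is_tau M Y : Prop := exists2 T, is_transpose M T & bimodule_iso (dualbim T) Y.

Definition is_taun (n : nat) M Y : Prop :=
  exists2 N, is_nth_syzygy n.-1 M N & is_tau N Y.

(* HH_n^tau(L, X), where Y is tau_n L *)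
Definition HHtau X Y : {vspace 'Hom(dualbim X, Y)} := bihom (dualbim X) Y.

End Transpose.

Arguments regbim {k} L : simpl never.
Arguments dualbim {k L} M : simpl never.
Arguments envbim {k} L : simpl never.
Arguments starbim {k L} P : simpl never.

(* Main.v *)
Require Import Defs.
From HB Require Import structures.
From mathcomp Require Import all_boot all_order all_algebra all_field.

(** Let e_v be the image in L of the stationary path at v. A bimodule M is the
    direct sum of its Peirce components e_i M e_j. Without oriented cycles,
    reachability is a partial order on the vertices, e_i L e_j is zero unless
    i <= j, and e_i L e_i is spanned by e_i. Everything follows from tracking
    which Peirce components can be nonzero.

    L itself lives on the pairs i <= j, and so do all its syzygies: a set of
    pairs that is closed under widening (i' <= i and j <= j') cuts out a
    sub-bimodule of every bimodule, so a projective cover lives where the module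
    it covers does ([cover_supported]). Furthermore the kernel of a projective
    cover is superfluous, hence has no diagonal component e_i K e_i
    ([superfluous_diag]), because the algebra acts on those components, modulo
    what lies off the diagonal, through the scalars e_i L e_i only. So in a
    minimal presentation P1 -> P0 -> N -> 0 of a syzygy N of L, the kernel of
    P0 -> N and with it P1 live on the pairs i < j ([presentation_supported]).

    Dualizing reverses the pairs: P1 is a summand of a sum of copies of
    L e_i (x) e_j L with i < j, so its dual Hom(P1, L (x) L) is generated by
    components e_j _ e_i with i < j ([star_generated]), and so is its quotient
    T, the transpose of N. A morphism from D L to D T pairs an element xi of D L
    with a generator e_j t e_i as it pairs e_i xi e_j with t. But e_i xi e_j
    only sees e_j L e_i, which is zero. So the morphism vanishes on generators,
    hence everywhere ([hom_dual0]). Since tau_n L is D T, this is the theorem. *)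

Set Implicit Arguments.
Unset Strict Implicit.
Unset Printing Implicit Defensive.

Import GRing.Theory.
Local Open Scope ring_scope.

(** * Preliminaries on linear forms and actions *)

Lemma functional_one (k : fieldType) (V : vectType k) (v : V) :
  v != 0 -> exists l : 'Hom(V, k^o), l v = 1.
Proof.
move=> v0; have [t vt] : exists t, coord (vbasis {:V}) t v != 0.
  apply/existsP; apply: contraNT v0 => /existsPn vc; apply/eqP.
  rewrite [LHS](coord_vbasis (memvf v)) big1 // => t _.
  by move/negPn/eqP: (vc t) => ->; rewrite scale0r.
exists ((coord (vbasis {:V}) t v)^-1 *: linfun (coord (vbasis {:V}) t : V -> k^o)).
by rewrite scale_lfunE lfunE; apply: mulVf.
Qed.

Section Actions.
Variables (k : fieldType) (L : falgType k).
Implicit Types (M : bimodule L) (a b : L).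

Lemma lact0l M (x : M) : lact 0 x = 0.
Proof. by rewrite -lmapE linear0 zero_lfunE. Qed.

Lemma lact0r M a : lact a (0 : M) = 0.
Proof. by rewrite -lmapE linear0. Qed.

Lemma ract0l M a : ract (0 : M) a = 0.
Proof. by rewrite -rmapE linear0. Qed.

Lemma ract0r M (x : M) : ract x 0 = 0.
Proof. by rewrite -rmapE linear0 zero_lfunE. Qed.

Lemma lactZl M c a (x : M) : lact (c *: a) x = c *: lact a x.
Proof. by rewrite -!lmapE linearZ scale_lfunE. Qed.

Lemma lactZr M c a (x : M) : lact a (c *: x) = c *: lact a x.
Proof. by rewrite -!lmapE linearZ. Qed.

Lemma lact_suml M (I : finType) (S : pred I) (F : I -> L) (x : M) :
  lact (\sum_(i | S i) F i) x = \sum_(i | S i) lact (F i) x.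
Proof.
rewrite -lmapE linear_sum sum_lfunE; apply: eq_bigr => i _; exact: lmapE.
Qed.

Lemma lact_sumr M a (I : finType) (S : pred I) (F : I -> M) :
  lact a (\sum_(i | S i) F i) = \sum_(i | S i) lact a (F i).
Proof. by rewrite -lmapE linear_sum; apply: eq_bigr => i _; exact: lmapE. Qed.

Lemma ractZr M c a (x : M) : ract x (c *: a) = c *: ract x a.
Proof. by rewrite -!rmapE linearZ scale_lfunE. Qed.

Lemma ract_suml M a (I : finType) (S : pred I) (F : I -> M) :
  ract (\sum_(i | S i) F i) a = \sum_(i | S i) ract (F i) a.
Proof. by rewrite -rmapE linear_sum; apply: eq_bigr => i _; exact: rmapE. Qed.

Lemma ract_sumr M (I : finType) (S : pred I) (F : I -> L) (x : M) :
  ract x (\sum_(i | S i) F i) = \sum_(i | S i) ract x (F i).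
Proof.
rewrite -rmapE linear_sum sum_lfunE; apply: eq_bigr => i _; exact: rmapE.
Qed.

End Actions.

(** * Peirce components over a triangular algebra *)

Section Peirce.
Variables (k : fieldType) (L : falgType k) (V : finType) (e : V -> L).
Variable le : rel V.
Implicit Types (M N P K : bimodule L) (S : rel V) (a b : L) (i j : V).

(** What acyclicity gives: the idempotents split L into an upper triangular
    algebra whose diagonal blocks have dimension at most one. *)
Record triangular : Prop := Triangular {
  idem_sum : \sum_i e i = 1;
  idem_orth : forall i j, i != j -> e i * e j = 0;
  idem_idem : forall i, e i * e i = e i;
  le_corner : forall i j a, ~~ le i j -> e i * a * e j = 0;
  diag_corner : forall i a, exists c : k, e i * a * e i = c *: e i;
  le_refl : reflexive le;
  le_trans : transitive le;
  le_anti : antisymmetric le }.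

Definition lt : rel V := fun i j => le i j && (i != j).

Definition peirce M i j : 'End(M) := (lmap M (e i) \o rmap M (e j))%VF.

Lemma peirceE M i j (x : M) : peirce M i j x = lact (e i) (ract x (e j)).
Proof. by rewrite comp_lfunE lmapE rmapE. Qed.

Definition supported S M : Prop :=
  forall i j (x : M), ~~ S i j -> peirce M i j x = 0.

(** Widening a pair of vertices in S stays in S. Multiplying an element of
    e_i M e_j by elements of L can only widen (i, j), so these are the relations
    for which the components in S form a sub-bimodule. *)
Definition outward S : Prop :=
  forall i' i j j', le i' i -> S i j -> le j j' -> S i' j'.

Lemma bihom_peirce M N (f : 'Hom(M, N)) i j x :
  f \in bihom M N -> f (peirce M i j x) = peirce N i j (f x).
Proof. by move=> /bihomP[fl fr]; rewrite !peirceE fl fr. Qed.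

Lemma supported_inj M N (f : 'Hom(N, M)) S :
  f \in bihom N M -> lker f = 0%VS ->
  (forall i j x, ~~ S i j -> peirce M i j (f x) = 0) -> supported S N.
Proof.
move=> fh /eqP/lker0P inj fS i j x nS; apply: inj.
by rewrite bihom_peirce // fS // linear0.
Qed.

Lemma supported_surj M N (f : 'Hom(M, N)) S :
  f \in bihom M N -> limg f = fullv -> supported S M -> supported S N.
Proof.
move=> fh fs MS i j x nS; have /memv_imgP[y _ ->] : x \in limg f by rewrite fs memvf.
by rewrite -bihom_peirce // MS // linear0.
Qed.

Section Theory.
Hypothesis tri : triangular.

Lemma lact_decomp M a (x : M) : lact a x = \sum_i lact (a * e i) x.
Proof. by rewrite -lact_suml -mulr_sumr (idem_sum tri) mulr1. Qed.

Lemma ract_decomp M a (x : M) : ract x a = \sum_i ract x (e i * a).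
Proof. by rewrite -ract_sumr -mulr_suml (idem_sum tri) mul1r. Qed.

Lemma peirce_sum M (x : M) : x = \sum_i \sum_j peirce M i j x.
Proof.
rewrite -[LHS]lact1 lact_decomp; apply: eq_bigr => i _; rewrite mul1r.
rewrite -[in LHS](ract1 x) ract_decomp lact_sumr.
by apply: eq_bigr => j _; rewrite mulr1 peirceE.
Qed.

Lemma peirceK M i j i' j' (x : M) :
  peirce M i j (peirce M i' j' x) = if (i == i') && (j == j') then peirce M i j x else 0.
Proof.
rewrite !peirceE -lractA -lactM lractA -ractM.
have [<-|ni] := eqVneq i i'; last by rewrite (idem_orth tri ni) lact0l.
rewrite (idem_idem tri) /= eq_sym.
have [<-|nj] := eqVneq j' j; last by rewrite (idem_orth tri nj) ract0r lact0r.
by rewrite (idem_idem tri).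
Qed.

Lemma outward_le : outward le.
Proof.
by move=> i' i j j' ii ij jj; apply: (le_trans tri ii); apply: (le_trans tri ij).
Qed.

Lemma outward_lt : outward lt.
Proof.
move=> i' i j j' ii /andP[ij nij] jj; rewrite /lt (outward_le ii ij jj) /=.
apply: contra nij => /eqP e'; rewrite -e' in jj; apply/eqP.
by apply: (le_anti tri); rewrite ij (le_trans tri jj ii).
Qed.

Lemma peirce_lact M i j a (x : M) :
  peirce M i j (lact a x) = \sum_(c | le i c) lact (e i * a) (peirce M c j x).
Proof.
rewrite peirceE lractA -lactM lact_decomp [LHS](bigID (le i)) /= addrC.
rewrite big1 ?add0r => [|c /(le_corner tri)->]; last exact: lact0l.
by apply: eq_bigr => c _; rewrite lactM peirceE.
Qed.

Lemma peirce_ract M i j b (x : M) :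
  peirce M i j (ract x b) = \sum_(c | le c j) ract (peirce M i c x) (b * e j).
Proof.
rewrite peirceE -ractM ract_decomp lact_sumr [LHS](bigID (le^~ j)) /= addrC.
rewrite big1 ?add0r => [|c nc].
  by apply: eq_bigr => c _; rewrite ractM peirceE lractA.
by rewrite mulrA (le_corner tri) // ract0r lact0r.
Qed.

(** The components of P in S form a sub-bimodule W, those outside S are killed by
    f; so W and the kernel of f span P, and superfluity makes W all of P. *)
Lemma cover_supported S M P (f : 'Hom(P, M)) :
  outward S -> f \in bihom P M -> superfluous (lker f) ->
  (forall i j x, ~~ S i j -> peirce M i j (f x) = 0) -> supported S P.
Proof.
move=> So fh fsup fS.
pose W : {vspace P} :=
  (\bigcap_(ij : V * V | ~~ S ij.1 ij.2) lker (peirce P ij.1 ij.2))%VS.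
have WP x : x \in W <-> (forall i j, ~~ S i j -> peirce P i j x = 0).
  rewrite memvE; split=> [/subv_bigcapP xW i j nS|xS].
    by apply/eqP; have := xW (i, j) nS; rewrite -memvE memv_ker.
  apply/subv_bigcapP => -[i j] nS; rewrite -memvE memv_ker; exact/eqP/xS.
have Wsub : subbimodule W.
  move=> a x /WP xW; split; apply/WP => i j nS.
    rewrite peirce_lact big1 // => c ic; rewrite xW ?lact0r //.
    by apply: contra nS => Scj; apply: (So _ _ _ _ ic Scj (le_refl tri _)).
  rewrite peirce_ract big1 // => c cj; rewrite xW ?ract0l //.
  by apply: contra nS => Sic; apply: (So _ _ _ _ (le_refl tri _) Sic cj).
have Wker : (W + lker f = fullv)%VS.
  apply/vspaceP => x; rewrite memvf (peirce_sum x).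
  apply: memv_suml => i _; apply: memv_suml => j _.
  have [Sij|nS] := boolP (S i j).
    apply: (subvP (addvSl _ _)); apply/WP => i' j' nS; rewrite peirceK.
    by case: andP => // -[/eqP ei /eqP ej]; rewrite ei ej Sij in nS.
  apply: (subvP (addvSr _ _)).
  by rewrite memv_ker (bihom_peirce _ _ _ fh) fS.
move=> i j x; move: i j; apply/WP.
by rewrite (fsup W Wsub Wker) memvf.
Qed.

(** This is the inclusion of a superfluous sub-bimodule in the radical, seen on
    the diagonal. If y in e_i K e_i were nonzero, choose a linear form l with
    l y = 1. The hyperplane of the z with l (e_i z e_i) = 0 is a sub-bimodule,
    because M lives on the pairs i <= j, which makes e_i (a z) e_i a multiple of
    e_i z e_i; together with y it spans M, so it would have to be M
    and contain y. *)
Lemma superfluous_diag M (K : {vspace M}) :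
  supported le M -> subbimodule K -> superfluous K ->
  forall i x, x \in K -> peirce M i i x = 0.
Proof.
move=> leM Ksub Ksup i x xK; pose y := peirce M i i x.
have yK : y \in K by rewrite /y peirceE; apply: (Ksub _ _ (Ksub _ _ xK).2).1.
have yy : peirce M i i y = y by rewrite peirceK !eqxx.
apply/eqP/negPn/negP => y0.
have [l ly] : exists l : 'Hom(M, k^o), l y = 1 by apply: functional_one.
pose U := lker (l \o peirce M i i)%VF.
have UE z : (z \in U) = (l (peirce M i i z) == 0) by rewrite memv_ker comp_lfunE.
have Usub : subbimodule U.
  move=> a z; rewrite !UE => /eqP lz; have [c ac] := diag_corner tri i a.
  split.
    rewrite peirce_lact (bigD1 i) ?(le_refl tri) //= big1 => [|i' /andP[ii' ne]].
      by rewrite peirceE addr0 -lactM ac lactZl -peirceE linearZ /= lz scaler0.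
    (* le i i' and i' != i exclude le i' i, so e_i' z e_i = 0 *)
    by rewrite leM ?lact0r //; apply: contra ne => i'i;
      apply/eqP; apply: (le_anti tri); rewrite i'i.
  rewrite peirce_ract (bigD1 i) ?(le_refl tri) //= big1 => [|i' /andP[ii' ne]].
    rewrite peirceE addr0 lractA -ractM mulrA ac ractZr lactZr -peirceE.
    by rewrite linearZ /= lz scaler0.
  by rewrite leM ?ract0l //; apply: contra ne => i'i;
    apply/eqP; apply: (le_anti tri); rewrite ii' i'i.
have UK : (U + K = fullv)%VS.
  apply/vspaceP => z; rewrite memvf.
  rewrite -(subrK (l (peirce M i i z) *: y) z).
  apply: memv_add; last by rewrite memvZ.
  have scale1 (c : k^o) : c *: (1 : k^o) = c by apply: mulr1.
  by rewrite UE !linearB !linearZ /= yy ly scalerN scale1 subrr.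
have := memvf y; rewrite -(Ksup U Usub UK) UE yy ly.
by rewrite oner_eq0.
Qed.

Lemma is_syzygy_supported M N :
  supported le M -> is_syzygy M N -> supported le N.
Proof.
move=> leM [P [f [u [[_ fh _ fsup] [uh uinj _]]]]].
apply: (supported_inj uh uinj) => i j x nS.
by apply: (cover_supported outward_le fh fsup) => // ? ? ? ?; apply: leM.
Qed.

Lemma nth_syzygy_supported M N m :
  supported le M -> is_nth_syzygy m M N -> supported le N.
Proof.
move=> leM; elim: m N => [|m IH] N /=.
  by case=> f [fh _ fs]; apply: (supported_surj fh fs).
by case=> N' /IH leN'; apply: is_syzygy_supported.
Qed.

(** Strictness enters with the kernel of f, which has no diagonal component, and
    passes to its cover P1 because the strict order is still outward. *)
Lemma presentation_supported M P0 P1 (f : 'Hom(P0, M)) (d : 'Hom(P1, P0)) :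
  supported le M -> minimal_presentation f d -> supported lt P1.
Proof.
move=> leM [[_ fh _ fsup] [_ dh dimg dsup]].
have leP0 : supported le P0.
  by apply: (cover_supported outward_le fh fsup) => ? ? ? ?; apply: leM.
have ksub : subbimodule (lker f).
  move: (fh) => /bihomP[fl fr] a x.
  by rewrite !memv_ker fl fr => /eqP->; rewrite lact0r ract0l eqxx.
apply: (cover_supported outward_lt dh dsup) => i j x.
have kx : d x \in lker f by rewrite -dimg memv_img ?memvf.
have [<- _|ne] := eqVneq i j; first exact: (superfluous_diag leP0 ksub fsup).
by rewrite /lt ne andbT => nle; apply: leP0.
Qed.

End Theory.
End Peirce.

(** * The dual basis of a projective bimodule *)

Section DualBasis.
Import VectorInternalTheory.
Variables (k : fieldType) (L : falgType k).
Implicit Types (M N P : bimodule L) (a b : L).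

Definition powbim (r : nat) M : bimodule L.
Proof.
refine (@Bimodule k L {ffun 'I_r -> M} (fun a x => [ffun s => lact a (x s)])
  (fun x b => [ffun s => ract (x s) b]) _ _ _ _ _ _ _ _ _)
  => [x c a b|a c x y|b c x y|x c a b|x|x|a b x|a b x|a b x];
  apply/ffunP => s; rewrite !ffunE.
- exact: (@lact_linl k L M).
- exact: (@lact_linr k L M).
- exact: (@ract_linl k L M).
- exact: (@ract_linr k L M).
- exact: lact1.
- exact: ract1.
- exact: lactM.
- exact: ractM.
- exact: lractA.
Defined.

(** The action of L (x) L^op on x, written a (x) b |-> a x b. *)
Lemma envact_ex M (x : M) :
  exists A : {linear tensor L -> M}, forall a b, A (tens a b) = lact a (ract x b).
Proof.
apply: (@tens_lift k L M (fun a b => lact a (ract x b))) => [b c a a'|a c b b'] /=.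
  exact: (@lact_linl k L M).
by rewrite (@ract_linr k L M) (@lact_linr k L M).
Qed.

Lemma envact_lact M (x : M) (A : {linear tensor L -> M}) a t :
  (forall a b, A (tens a b) = lact a (ract x b)) ->
  A (lact a (t : envbim L)) = lact a (A t).
Proof.
move=> AE; rewrite -[lact a (A t)]lmapE.
apply: (@tens_ind k L M (A \o tmap (amull a) \1) (lmap M a \o A)) => b c /=.
by rewrite tmap_tens !AE lmapE -lactM !lfunE.
Qed.

Lemma envact_ract M (x : M) (A : {linear tensor L -> M}) a t :
  (forall a b, A (tens a b) = lact a (ract x b)) ->
  A (ract (t : envbim L) a) = ract (A t) a.
Proof.
move=> AE; rewrite -[ract (A t) a]rmapE.
apply: (@tens_ind k L M (A \o tmap \1 (amulr a)) (rmap M a \o A)) => b c /=.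
by rewrite tmap_tens !AE rmapE lractA -ractM !lfunE.
Qed.

(** The free bimodule on a linear basis x of P maps onto P; the phi s are the
    coordinates of a section of that map, which exists because P is
    projective. *)
Lemma dual_basis P : projective P ->
  exists (r : nat) (x : 'I_r -> P) (A : 'I_r -> {linear tensor L -> P})
      (phi : 'I_r -> 'Hom(P, envbim L)),
    [/\ forall s a b, A s (tens a b) = lact a (ract (x s) b),
        forall s, phi s \in bihom P (envbim L)
      & forall p, p = \sum_s A s (phi s p)].
Proof.
move=> projP; pose r := \dim {:P}; pose x (s : 'I_r) : P := (vbasis {:P})`_s.
have [A AE] := fin_all_exists (fun s => envact_ex (x s)).
pose F := powbim r (envbim L).
pose g0 (t : F) : P := \sum_s A s (t s).
have g0lin : linear g0.
  move=> c t u; rewrite /g0 scaler_sumr -big_split; apply: eq_bigr => s _ /=.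
  by rewrite !ffunE linearP.
pose gL : {linear F -> P} := HB.pack g0 (GRing.isLinear.Build k F P _ g0 g0lin).
pose g : 'Hom(F, P) := linfun gL.
have gE (t : F) : g t = \sum_s A s (t s) by rewrite lfunE.
have gh : g \in bihom F P.
  apply/bihomP; split=> a t; rewrite !gE.
    rewrite lact_sumr; apply: eq_bigr => s _.
    by rewrite ffunE (envact_lact _ _ (AE s)).
  rewrite ract_suml; apply: eq_bigr => s _.
  by rewrite ffunE (envact_ract _ _ (AE s)).
have gs : limg g = fullv.
  apply/vspaceP => p; rewrite memvf; apply/memv_imgP.
  exists [ffun s => coord (vbasis {:P}) s p *: tens 1 1]; first exact: memvf.
  rewrite gE [LHS](coord_vbasis (memvf p)); apply: eq_bigr => s _.
  by rewrite ffunE linearZ /= AE lact1 ract1.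
have idh : \1%VF \in bihom P P by apply/bihomP; split=> a p; rewrite !id_lfunE.
have [h hh gK] := projP F P g \1%VF gh gs idh.
pose ev s (t : F) : envbim L := t s.
have evlin s : linear (ev s) by move=> c t u; rewrite /ev !ffunE.
pose evL s : {linear F -> envbim L} :=
  HB.pack (ev s) (GRing.isLinear.Build k F (envbim L) _ (ev s) (evlin s)).
have hE s p : (linfun (evL s) \o h)%VF p = h p s by rewrite comp_lfunE lfunE.
exists r, x, A, (fun s => linfun (evL s) \o h)%VF; split => [//|s|p].
  move/bihomP: hh => [hl hr].
  by apply/bihomP; split=> a p; rewrite !hE ?hl ?hr ffunE.
transitivity ((g \o h)%VF p); first by rewrite gK id_lfunE.
by rewrite comp_lfunE gE; apply: eq_bigr => s _; rewrite hE.
Qed.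

End DualBasis.

(** * Duals live on the reversed pairs *)

Section Dual.
Import VectorInternalTheory.
Variables (k : fieldType) (L : falgType k) (V : finType) (e : V -> L).
Variable le : rel V.
Hypothesis tri : triangular e le.
Implicit Types (M N P T : bimodule L) (a b : L).

Definition generated (S : rel V) M : Prop :=
  forall U : {vspace M}, subbimodule U ->
    (forall i j x, S i j -> peirce e M i j x \in U) -> U = fullv.

Lemma generated_surj M N (f : 'Hom(M, N)) S :
  f \in bihom M N -> limg f = fullv -> generated S M -> generated S N.
Proof.
move=> fh fs Mgen U Usub US; apply/eqP; rewrite eqEsubv subvf /= -fs.
have fU : (f @^-1: U)%VS = fullv.
  apply: Mgen => [a x|i j x Sij].
    move: (fh) => /bihomP[fl fr]; rewrite -!memv_preim => fx.
    by rewrite fl fr; apply: Usub.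
  by rewrite -memv_preim (bihom_peirce _ _ _ _ fh) US.
by apply/subvP => _ /memv_imgP[x _ ->]; rewrite memv_preim fU memvf.
Qed.

Lemma star_lactE P a (f : starbim P) p :
  vsval (lact a f : starbim P) p = tmap \1 (amull a) (vsval f p).
Proof. by rewrite vsprojK ?innerl_bihom ?subvsP // comp_lfunE innerlE. Qed.

Lemma star_ractE P a (f : starbim P) p :
  vsval (ract f a : starbim P) p = tmap (amulr a) \1 (vsval f p).
Proof. by rewrite vsprojK ?innerr_bihom ?subvsP // comp_lfunE innerrE. Qed.

Lemma star_peirceE P a b i j (f : starbim P) p :
  vsval (lact b (ract (peirce e (starbim P) j i f) a) : starbim P) p =
  tmap (amulr (e i * a)) (amull (b * e j)) (vsval f p).
Proof.
rewrite peirceE star_lactE star_ractE star_lactE star_ractE -!tmapM.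
rewrite !comp_lfun1l !comp_lfun1r.
congr tmap; apply/lfunP => x; rewrite comp_lfunE !lfunE /= ?lfunE /= mulrA //.
Qed.

Lemma env_lactE a (t : envbim L) : lact a t = tmap (amull a) \1 t.
Proof. by []. Qed.

Lemma env_ractE a (t : envbim L) : ract t a = tmap \1 (amulr a) t.
Proof. by []. Qed.

(** By the dual basis, every f in the dual of P is the sum over s of the result of
    acting on phi s by the tensor f (x s). Since x s only has components
    e_i (x s) e_j with i < j, that tensor may be multiplied by the
    e_i (x) e_j, and for the inner action this replaces phi s by its components
    e_j (phi s) e_i. *)
Lemma star_generated P :
  projective P -> supported e (lt le) P ->
  generated (fun j i => lt le i j) (starbim P).
Proof.
move=> projP ltP U Usub US; apply/vspaceP => f; rewrite memvf.
have [r [x [A [phi [AE phih phiK]]]]] := dual_basis projP.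
pose eps (u : 'I_(dim L)) : L := r2v (delta_mx 0 u).
pose F : 'Hom(P, envbim L) := vsval f.
have Fh : F \in bihom P (envbim L) by apply: subvsP.
pose m s : tensor L := F (x s).
(* phi s seen in the dual of P *)
pose phi' s : starbim P := vsproj (bihom P (envbim L)) (phi s).
(* The outer action of w on x s goes through F; on pure tensors w = c (x) d both
   sides are the part i < j of c F(x s) d. *)
have Fw s w : F (A s w) = \sum_i \sum_(j | lt le i j) \sum_u \sum_v
    m s u v *: tmap (amulr (e i * eps u)) (amull (eps v * e j)) w.
  (* the right-hand side packaged as a linear map, to compare on pure tensors *)
  pose G : 'Hom(tensor L, envbim L) := \sum_i \sum_(j | lt le i j) \sum_u \sum_v
    m s u v *: linfun (tmap (amulr (e i * eps u)) (amull (eps v * e j))).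
  have GE t : G t = \sum_i \sum_(j | lt le i j) \sum_u \sum_v
      m s u v *: tmap (amulr (e i * eps u)) (amull (eps v * e j)) t.
    rewrite sum_lfunE; apply: eq_bigr => i _.
    rewrite sum_lfunE; apply: eq_bigr => j _.
    rewrite sum_lfunE; apply: eq_bigr => u _.
    rewrite sum_lfunE; apply: eq_bigr => v _.
    by rewrite scale_lfunE lfunE.
  rewrite -GE; apply: (@tens_ind k L (envbim L) (F \o A s) G) => c d /=.
  rewrite AE; move: (Fh) => /bihomP[-> ->].
  have -> : F (x s) = \sum_i \sum_(j | lt le i j) peirce e (envbim L) i j (F (x s)).
    rewrite {1}(peirce_sum tri (x s)) linear_sum; apply: eq_bigr => i _.
    rewrite linear_sum [RHS]big_mkcond; apply: eq_bigr => j _ /=.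
    rewrite -(bihom_peirce _ _ _ _ Fh); case: ifPn => // nij.
    by rewrite ltP // linear0.
  rewrite ract_suml lact_sumr GE; apply: eq_bigr => i _.
  rewrite ract_suml lact_sumr; apply: eq_bigr => j _.
  rewrite peirceE !(env_lactE, env_ractE) -!tmapM [F (x s)]tensE linear_sum.
  apply: eq_bigr => u _; rewrite linear_sum; apply: eq_bigr => v _.
  rewrite linearZ; congr (_ *: _); rewrite [LHS]tmap_tens tmap_tens.
  rewrite !comp_lfun1l !comp_lfun1r !comp_lfunE !lfunE /=.
  by congr tens; rewrite !mulrA.
have fE : f = \sum_s \sum_i \sum_(j | lt le i j) \sum_u \sum_v m s u v *:
    lact (eps v) (ract (peirce e (starbim P) j i (phi' s)) (eps u)).
  apply: val_inj; apply/lfunP => p.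
  rewrite -[LHS]/(F p) [in LHS](phiK p) !linear_sum sum_lfunE; apply: eq_bigr => s _.
  rewrite [LHS]Fw linear_sum sum_lfunE; apply: eq_bigr => i _.
  rewrite linear_sum sum_lfunE; apply: eq_bigr => j _.
  rewrite linear_sum sum_lfunE; apply: eq_bigr => u _.
  rewrite linear_sum sum_lfunE; apply: eq_bigr => v _.
  by rewrite linearZ scale_lfunE star_peirceE vsprojK.
rewrite fE; do 5! apply: memv_suml => ? ?.
by apply/memvZ/(Usub _ _ _).1/(Usub _ _ _).2/US.
Qed.

(** The type of dualbim M hides that its elements are linear forms. *)
Definition ev M (xi : dualbim M) : 'Hom(M, k^o) := xi.

Lemma dual_lactE M a (xi : dualbim M) x : ev (lact a xi) x = ev xi (ract x a).
Proof. by rewrite [LHS]comp_lfunE rmapE. Qed.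

Lemma dual_ractE M a (xi : dualbim M) x : ev (ract xi a) x = ev xi (lact a x).
Proof. by rewrite [LHS]comp_lfunE lmapE. Qed.

Lemma dual_supported S M :
  supported e S M -> supported e (fun i j => S j i) (dualbim M).
Proof.
move=> MS i j xi nS; apply/lfunP => x; rewrite peirceE -[LHS]/(ev _ x).
by rewrite dual_lactE dual_ractE -peirceE MS // linear0 [RHS]zero_lfunE.
Qed.

(** The t annihilated by all h xi form a sub-bimodule U of T. It contains every
    e_j t e_i with i < j, since (h xi) (e_j t e_i) = h (e_i xi e_j) t and
    e_i xi e_j = 0, xi being a linear form on a module with no component
    (j, i). *)
Lemma hom_dual0 M T (h : 'Hom(dualbim M, dualbim T)) :
  supported e le M -> generated (fun j i => lt le i j) T ->
  h \in bihom (dualbim M) (dualbim T) -> h = 0.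
Proof.
move=> leM genT hh; have [hl hr] := (bihomP _).1 hh.
pose b := vbasis {: dualbim M}.
(* a basis b of the dual of M makes U a finite intersection *)
pose U : {vspace T} := (\bigcap_(s < \dim {: dualbim M}) lker (ev (h b`_s)))%VS.
have UP t : t \in U <-> forall xi, ev (h xi) t = 0.
  rewrite memvE; split=> [/subv_bigcapP tU xi|t0].
    rewrite (coord_vbasis (memvf xi)) linear_sum [LHS]sum_lfunE big1 // => s _.
    rewrite linearZ [LHS]scale_lfunE; have := tU s isT.
    by rewrite -memvE memv_ker => /eqP->; rewrite scaler0.
  by apply/subv_bigcapP => s _; rewrite -memvE memv_ker t0.
have Ufull : U = fullv.
  apply: genT => [a t /UP tU|j i t /andP[le_ij ne]].
    by split; apply/UP => xi; rewrite -(dual_lactE, dual_ractE) -(hl, hr).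
  apply/UP => xi; rewrite peirceE -dual_ractE -dual_lactE -hr -hl -peirceE.
  rewrite (dual_supported leM) ?linear0 ?[LHS]zero_lfunE //.
  by apply: contra ne => ji; apply/eqP/(le_anti tri); rewrite ji le_ij.
apply/lfunP => xi; apply/lfunP => t; rewrite zero_lfunE.
have /UP : t \in U by rewrite Ufull memvf.
by rewrite zero_lfunE; apply.
Qed.

End Dual.

(** * The algebra of an acyclic quiver is triangular *)

Section PathOrder.
Variable Q : quiver.
Implicit Types (x y : vertex Q) (p : qpath Q).

Definition adjacent : rel (vertex Q) :=
  fun x y => [exists a : arrow Q, (asource a == x) && (atarget a == y)].

Lemma connect_qpath p : connect adjacent (psource p) (ptarget p).
Proof.
rewrite /ptarget /psource /parrows; case: p => -[x s] /= xs.
elim: s x xs => //= a s IH x /andP[/eqP ax /IH]; apply: connect_trans.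
by apply/connect1/existsP; exists a; rewrite ax !eqxx.
Qed.

Lemma qpath_connect x y :
  connect adjacent x y -> exists2 p, psource p = x & ptarget p = y.
Proof.
case/connectP => s; elim: s x => [|z s IH] x /=.
  by move=> _ ->; exists (stationary x).
case/andP => /existsP[a /andP[/eqP ax /eqP az]] /IH{}IH /IH[p pz py].
have ap : ptarget (arrow_path a) = psource p by rewrite pz.
by exists (pcat (arrow_path a) p); rewrite ?psource_cat ?ptarget_cat.
Qed.

Lemma plength0 p : plength p = 0%N -> p = stationary (psource p).
Proof. by move/size0nil => p0; apply: qpath_eq; rewrite ?p0. Qed.

(** A path from x to y followed by one from y to x is closed, so it is
    stationary. *)
Lemma connect_acyclic_anti : acyclic Q -> antisymmetric (connect adjacent).
Proof.
move=> acQ x y /andP[/qpath_connect[p px py] /qpath_connect[q qy qx]].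
have pq : ptarget p = psource q by rewrite py qy.
have := acQ (pcat p q); rewrite psource_cat // ptarget_cat // px qx => /(_ erefl).
rewrite /plength parrows_cat // size_cat => /eqP; rewrite addn_eq0 => /andP[/eqP p0 _].
by rewrite -px -py (plength0 p0).
Qed.

End PathOrder.

Section PathQuotient.
Variables (k : fieldType) (Q : quiver) (L : falgType k).
Variable pi : {rmorphism pathalg k Q -> L}.

Definition vertex_idem (v : vertex Q) : L := pi (pbasis k (stationary v)).

Lemma mul_pbasis (p q : qpath Q) :
  (pbasis k p : pathalg k Q) * pbasis k q = ppmul k p q.
Proof. exact: pamul_basis. Qed.

Lemma corner_pbasis i j (p : qpath Q) :
  (pbasis k (stationary i) : pathalg k Q) * pbasis k p * pbasis k (stationary j)
  = if (psource p == i) && (ptarget p == j) then pbasis k p : pathalg k Q else 0.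
Proof.
rewrite mul_pbasis {1}/ppmul [ptarget _]/= eq_sym.
have [<-|_] := eqVneq (psource p) i; last by rewrite mul0r.
rewrite pcat0p mul_pbasis /ppmul [psource (stationary j)]/=.
by have [<-|] := eqVneq (ptarget p) j; rewrite ?pcatp0.
Qed.

(** The corner e_i L e_j is spanned by the classes of the paths from i to j. *)
Lemma corner_ind (U : L -> Prop) i j : scalable pi ->
  (forall y, exists x, pi x = y) ->
  U 0 -> (forall x y, U x -> U y -> U (x + y)) -> 
  (forall c p, psource p = i -> ptarget p = j -> U (c *: pi (pbasis k p))) ->
  forall a, U (vertex_idem i * a * vertex_idem j).
Proof.
move=> piZ piS U0 UD Up a; have [x <-] := piS a.
elim/pathalg_ind: x => [|x y Ux Uy|c p].
- by rewrite rmorph0 mulr0 mul0r.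
- by rewrite rmorphD mulrDr mulrDl; apply: UD.
rewrite [pi _]piZ -scalerAr -scalerAl -!rmorphM corner_pbasis.
case: andP => [[/eqP pi_ /eqP pj]|_]; first exact: Up.
by rewrite rmorph0 scaler0.
Qed.

Lemma path_quotient_triangular (I : pathalg k Q -> Prop) :
  is_path_quotient I pi -> acyclic Q ->
  triangular vertex_idem (connect (@adjacent Q)).
Proof.
case=> piZ piS _ acQ; split.
- by rewrite -rmorph_sum; apply: (rmorph1 pi).
- move=> i j ij; rewrite -rmorphM mul_pbasis /ppmul.
  by rewrite [_ == _](negPf ij) rmorph0.
- move=> i; rewrite -rmorphM mul_pbasis /ppmul [_ == _]eqxx.
  by rewrite (pcat0p (stationary i)).
- move=> i j a nij; apply: (corner_ind (U := fun y => y = 0)) => // [x y -> ->|c p pi_ pj].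
    by rewrite addr0.
  by rewrite -pi_ -pj connect_qpath in nij.
- move=> i; apply: (corner_ind (U := fun y => exists c, y = c *: vertex_idem i)) => //.
  + by exists 0; rewrite scale0r.
  + by move=> _ _ [c ->] [d ->]; exists (c + d); rewrite scalerDl.
  move=> c p pi_ pj; exists c.
  by rewrite (plength0 (acQ p _)) ?pi_ ?pj.
- exact: connect0.
- exact: connect_trans.
exact: connect_acyclic_anti.
Qed.

Lemma regbim_supported (le : rel (vertex Q)) :
  triangular vertex_idem le -> supported vertex_idem le (regbim L).
Proof.
move=> tri i j x nS; rewrite peirceE -lractA; exact: le_corner nS.
Qed.

End PathQuotient.

(** * Vanishing of the homology *)

Theorem theorem4p17 (k : fieldType) (Q : quiver) (I : pathalg k Q -> Prop)
    (L : falgType k) (pi : {rmorphism pathalg k Q -> L}) :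
  admissible I -> is_path_quotient I pi -> acyclic Q ->
  forall (n : nat) (tau_nL : bimodule L), (1 <= n)%N ->
    is_taun n (regbim L) tau_nL -> HHtau (regbim L) tau_nL = 0%VS.
Proof.
move=> _ piQ acQ n Y _ [N synN [T [P0 [P1 [f [d [q [pres [qh qs _]]]]]]] [g [gh gi gs]]]].
have tri := path_quotient_triangular piQ acQ.
have leL := regbim_supported tri.
have leN := nth_syzygy_supported tri leL synN.
have ltP1 := presentation_supported tri leN pres.
have projP1 : projective P1 by case: pres => _ [].
have genT := generated_surj qh qs (star_generated tri projP1 ltP1).
(* g identifies D T with tau_n L; transport h back along g *)
apply/eqP; rewrite -subv0; apply/subvP => h hh; rewrite memv0.
have gK : cancel g (g^-1)%VF by move=> x; apply: lker0_lfunK; apply/eqP.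
have gVK : cancel (g^-1)%VF g.
  by move=> y; have /memv_imgP[x _ ->] : y \in limg g; rewrite ?gK ?gs ?memvf.
have [gl gr] := (bihomP _).1 gh; have [hl hr] := (bihomP _).1 hh.
have kh : (g^-1 \o h)%VF \in bihom (dualbim (regbim L)) (dualbim T).
  apply/bihomP; split=> a x; apply: (can_inj gK); rewrite ?gl ?gr !comp_lfunE !gVK.
    exact: hl.
  exact: hr.
have h0 := hom_dual0 tri leL genT kh.
apply/eqP/lfunP => x; rewrite -[LHS]gVK.
have := congr1 (fun u : 'Hom(_, _) => u x) h0; rewrite comp_lfunE => ->.
by rewrite !zero_lfunE linear0.
Qed.
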